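(* Let $X_1,X_2,\ldots$ be mean zero i.i.d. symmetric real random variables, let $S_k=X_1+\cdots+X_k$, and for $n\ge 1$ let $$p_n^{(1)}=\mathbb{P}\left(\max_{1\le k\le n}S_k<0\right),\qquad \overline{p}_n^{(1)}=\mathbb{P}\left(\max_{1\le k\le n}S_k\le 0\right).$$ Then for all $n\ge 1$, $$p_n^{(1)}\le \frac{(2n-1)!!}{(2n)!!}\le \overline{p}_n^{(1)}.$$ In particular, if $X_1$ also has a density, then for all $n\ge 1$, $$p_n^{(1)}=\frac{(2n-1)!!}{(2n)!!}.$$
   Context: Symmetric means that $X_1$ and $-X_1$ have the same distribution. The double factorials are $(2n-1)!!=1\cdot 3\cdots(2n-1)$ and $(2n)!!=2\cdot 4\cdots(2n)$. ''Has a density'' means that the law of $X_1$ is absolutely continuous with respect to Lebesgue measure on $\mathbb{R}$. *)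

(* Defs.v *)
From HB Require Import structures.
From mathcomp Require Import all_boot all_order all_algebra.
From mathcomp Require Import all_classical all_reals all_analysis.

Set Implicit Arguments.
Unset Strict Implicit.
Unset Printing Implicit Defensive.

Import Order.TTheory GRing.Theory Num.Theory.
Import numFieldNormedType.Exports.

Local Open Scope classical_set_scope.
Local Open Scope ring_scope.

(* The sequence is indexed from 0: [X i] stands for the variable X_{i+1}. *)

Definition independent_RVs (R : realType) (d : measure_display)
    (T : measurableType d) (P : probability T R) (X : nat -> {RV P >-> R}) : Prop :=
  forall (J : seq nat) (B : nat -> set R),
    uniq J -> (forall j, j \in J -> measurable (B j)) ->
    P (\bigcap_(j in [set` J]) (X j @^-1` B j)) =
    (\prod_(j <- J) P (X j @^-1` B j))%E.

Definition same_distribution (R : realType) (d : measure_display)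
    (T : measurableType d) (P : probability T R) (X Y : T -> R) : Prop :=
  forall A : set R, measurable A -> pushforward P X A = pushforward P Y A.

Definition symmetric_RV (R : realType) (d : measure_display)
    (T : measurableType d) (P : probability T R) (X : T -> R) : Prop :=
  same_distribution P X (\- X).

Definition mean_zero (R : realType) (d : measure_display)
    (T : measurableType d) (P : probability T R) (X : T -> R) : Prop :=
  P.-integrable setT (EFin \o X) /\ ('E_P[X] = 0)%E.

Definition has_density (R : realType) (d : measure_display)
    (T : measurableType d) (P : probability T R) (X : {RV P >-> R}) : Prop :=
  distribution P X `<< @lebesgue_measure R.

Definition partial_sum (R : realType) (T : Type) (X : nat -> T -> R)
  (k : nat) (w : T) : R := \sum_(i < k) X i w.

(* max_{1 <= k <= n} S_k; seeding with S_1 makes this the true maximum as soon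
   as 1 <= n, the only case in which it is used. *)
Definition max_partial_sum (R : realType) (T : Type) (X : nat -> T -> R)
  (n : nat) (w : T) : R :=
  \big[Num.max/partial_sum X 1 w]_(1 <= k < n.+1) partial_sum X k w.

Definition persistence (R : realType) (d : measure_display)
    (T : measurableType d) (P : probability T R) (X : nat -> {RV P >-> R})
    (n : nat) : \bar R :=
  P [set w | max_partial_sum X n w < 0].

Definition weak_persistence (R : realType) (d : measure_display)
    (T : measurableType d) (P : probability T R) (X : nat -> {RV P >-> R})
    (n : nat) : \bar R :=
  P [set w | max_partial_sum X n w <= 0].

(* m!!, the product of the integers in [1, m] of the same parity as m *)
Definition double_factorial (m : nat) : nat :=
  (\prod_(1 <= k < m.+1 | odd k == odd m) k)%N.

(* Main.v *)
(* Write p_n, pb_n for the strict and weak persistence probabilities, e_n for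
   the probability that S_1, ..., S_(n-1) < 0 = S_n, and P, Pb, E for their
   generating series. Cutting the path at its first maximum over {0, ..., n},
   and reversing and negating the part before it, gives sum_k p_k pb_(n-k) = 1,
   i.e. P Pb = 1 / (1 - x). Cutting a nonpositive path at its first return to 0
   gives Pb = P + E Pb. With A = (1 - x)^(-1/2), whose coefficients are
   (2n-1)!!/(2n)!!, this yields P = A Q and Pb = A / Q where Q^2 = 1 - E. As E
   has nonnegative coefficients, those of Q are nonpositive except the constant
   one, so 1 / Q has nonnegative coefficients, and P <= A <= Pb follows
   coefficientwise. If the law has no atoms then E = 0, so P = Pb = A. *)

Require Import Defs.
From HB Require Import structures.
From mathcomp Require Import all_boot all_order all_algebra.
From mathcomp Require Import all_classical all_reals all_analysis.
From mathcomp Require Import ring lra.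

Set Implicit Arguments.
Unset Strict Implicit.
Unset Printing Implicit Defensive.

Import Order.TTheory GRing.Theory Num.Theory.
Import numFieldNormedType.Exports.

Local Open Scope classical_set_scope.
Local Open Scope ring_scope.

(** * Sequences under the Cauchy product *)

Section Convolution.
Context {R : comNzRingType}.
Implicit Types f g h : nat -> R.

Definition conv f g : nat -> R := fun n => \sum_(k < n.+1) f k * g (n - k)%N.

Definition conv_one : nat -> R := fun n => (n == 0)%:R.

(** Up to any given degree, sequences multiply like their truncations to polynomials, so the laws of
    [conv] are inherited from polynomial multiplication. *)
Lemma convE f g n m : (n < m)%N ->
  conv f g n = ((\poly_(i < m) f i) * (\poly_(i < m) g i))`_n.
Proof.
move=> nm; rewrite coefM; apply: eq_bigr => k _; rewrite !coef_poly.
by rewrite (leq_ltn_trans (leq_ord k) nm) (leq_ltn_trans (leq_subr k n) nm).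
Qed.

Lemma convC : commutative conv.
Proof. by move=> f g; apply/funext => n; rewrite !(@convE _ _ n n.+1)// mulrC. Qed.

Lemma convA : associative conv.
Proof.
have coef_conv f g n k : (k <= n)%N ->
    (\poly_(i < n.+1) conv f g i)`_k =
    ((\poly_(i < n.+1) f i) * (\poly_(i < n.+1) g i))`_k.
  by move=> kn; rewrite coef_poly ltnS kn (@convE _ _ k n.+1).
move=> f g h; apply/funext => n; rewrite !(@convE _ _ n n.+1)//.
transitivity ((\poly_(i < n.+1) f i) * ((\poly_(i < n.+1) g i) *
   (\poly_(i < n.+1) h i)))`_n.
  rewrite 2!coefM; apply: eq_bigr => k _; congr (_ * _).
  by rewrite coef_conv ?leq_subr.
rewrite mulrA 2!coefM; apply: eq_bigr => k _; congr (_ * _).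
by rewrite coef_conv ?leq_ord.
Qed.

Lemma conv1l : left_id conv_one conv.
Proof.
move=> f; apply/funext => n; rewrite /conv big_ord_recl subn0 mul1r big1 ?addr0//.
by move=> i _; rewrite mul0r.
Qed.

(** Registering the commutative monoid lets [AC] rearrange long convolutions. *)
HB.instance Definition _ :=
  Monoid.isComLaw.Build (nat -> R) conv_one conv convA convC conv1l.

Lemma conv_at0 f g : conv f g 0%N = f 0%N * g 0%N.
Proof. by rewrite /conv big_ord1. Qed.

Definition one_minus_x : nat -> R := fun n => (n == 0)%:R - (n == 1)%:R.

Lemma conv_cst1_one_minus_x : conv (fun=> 1) one_minus_x = conv_one.
Proof.
apply/funext => n; rewrite convC /conv; case: n => [|n].
  by rewrite big_ord1 /one_minus_x /conv_one/= subr0 mulr1.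
rewrite 2!big_ord_recl big1 => [|i _].
  by rewrite /one_minus_x /conv_one/= !mulr1 addr0 subr0 sub0r subrr.
by rewrite /one_minus_x/= subrr mul0r.
Qed.

End Convolution.

(** * The series of (1 - x)^(-1/2), and signs of coefficients of roots and inverses *)

Section CentralBinomial.
Context {R : realFieldType}.

(* C(2n, n) / 4^n, the coefficients of (1 - x)^(-1/2). *)
Definition cbin (n : nat) : R := \prod_(k < n) ((2 * k + 1)%:R / (2 * k + 2)%:R).

Lemma cbinS n : (2 * n + 2)%:R * cbin n.+1 = (2 * n + 1)%:R * cbin n.
Proof.
rewrite /cbin big_ord_recr/= mulrCA mulrC; congr (_ * _).
by rewrite mulrCA mulfV ?mulr1// pnatr_eq0 addn2.
Qed.

Lemma cbin_ge0 n : 0 <= cbin n.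
Proof. by apply: prodr_ge0 => k _; rewrite divr_ge0. Qed.

(** The exchange of k and n - k shows that the weights k and n - k give equal sums; together they
    weigh n. *)
Lemma conv_cbin_sym n :
  (\sum_(k < n.+1) (2 * k)%:R * cbin k * cbin (n - k)) = n%:R * conv cbin cbin n.
Proof.
have e : \sum_(k < n.+1) k%:R * cbin k * cbin (n - k) =
         \sum_(k < n.+1) (n - k)%:R * cbin k * cbin (n - k).
  rewrite (reindex_inj rev_ord_inj)/=; apply: eq_bigr => k _.
  by rewrite subSS subKn ?leq_ord// mulrAC.
transitivity (\sum_(k < n.+1) k%:R * cbin k * cbin (n - k) +
         \sum_(k < n.+1) (n - k)%:R * cbin k * cbin (n - k)).
  rewrite -{}e -big_split/=; apply: eq_bigr => k _.
  by rewrite mul2n -addnn natrD !mulrDl.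
rewrite -big_split/= /conv mulr_sumr; apply: eq_bigr => k _.
by rewrite -!mulrDl -natrD subnKC ?leq_ord// mulrA.
Qed.

(** Induction on n: in (n + 1) times the coefficient n + 1, [cbinS] turns each (2k + 2) a_(k+1) into
    (2k + 1) a_k, which leaves n + 1 times the coefficient n. *)
Lemma conv_cbin : conv cbin cbin = fun=> 1.
Proof.
apply/funext; elim => [|n IHn].
  by rewrite conv_at0 /cbin !big_ord0 mulr1.
apply: (@mulfI _ n.+1%:R); first by rewrite pnatr_eq0.
rewrite -conv_cbin_sym big_ord_recl/= muln0 !mul0r add0r.
transitivity (\sum_(k < n.+1) (2 * k)%:R * cbin k * cbin (n - k) + conv cbin cbin n).
  rewrite /conv -big_split/=; apply: eq_bigr => k _.
  rewrite /bump/= add1n subSS mulnS addnC cbinS natrD; ring.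
by rewrite conv_cbin_sym IHn -natr1 mulrDl mul1r.
Qed.

Lemma double_factorialSS m :
  double_factorial m.+2 = (m.+2 * double_factorial m)%N.
Proof.
rewrite /double_factorial big_mkcond big_nat_recr//= big_nat_recr//=.
rewrite negbK eqxx -big_mkcond/= mulnC; congr muln.
rewrite (_ : (if _ then _ else _) = 1%N) ?muln1; last by case: (odd m).
by [].
Qed.

Lemma double_factorial_cbin n :
  (double_factorial (2 * n - 1))%:R / (double_factorial (2 * n))%:R = cbin n.
Proof.
elim: n => [|n IHn].
  by rewrite muln0 sub0n /double_factorial !big_nil divr1 /cbin big_ord0.
have -> : (2 * n.+1 = (2 * n).+2)%N by rewrite mulnS.
rewrite double_factorialSS subn1/=.
have -> : double_factorial (2 * n).+1 =
          ((2 * n).+1 * double_factorial (2 * n - 1))%N.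
  (* For n = 0 the subtraction 2 * 0 - 1 truncates to 0, and [double_factorial 0] is an empty
     product. *)
  case: n {IHn} => [|n]; last by rewrite mulnS add2n subn1 double_factorialSS.
  by rewrite muln0 /double_factorial !big_mkcond big_nat1 big_nil.
by rewrite !natrM -mulf_div IHn /cbin big_ord_recr/= -/(cbin n) mulrC addn1 addn2.
Qed.

(** The coefficient n + 1 of q^2 is 2 q_(n+1) plus products of two earlier nonconstant coefficients,
    which are nonnegative by strong induction. *)
Lemma conv_sqrt_le0 (q e : nat -> R) :
  q 0%N = 1 -> conv q q = e -> (forall n, e n.+1 <= 0) -> forall n, q n.+1 <= 0.
Proof.
move=> q0 qq e_le0 n; have [m] := ubnP n; elim: m n => // m IHm n nm.
have := e_le0 n; rewrite -qq /conv big_ord_recl big_ord_recr/= /bump/= add1n.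
rewrite subnn subn0 q0 mul1r mulr1.
suff : 0 <= \sum_(i < n) q (1 + i)%N * q (n.+1 - (1 + i))%N by lra.
apply: sumr_ge0 => i _; rewrite add1n subSS -[(n - i)%N]prednK ?subn_gt0//.
apply: mulr_le0; apply: IHm; first exact: leq_trans (ltn_ord i) nm.
by rewrite prednK ?subn_gt0// (leq_trans (leq_subr _ _))// -ltnS.
Qed.

(** The relation r q = 1 expresses r_(n+1) as minus the sum of the r_k q_(n+1-k) over k <= n, so
    strong induction applies. *)
Lemma conv_inv_ge0 (q r : nat -> R) :
  q 0%N = 1 -> conv r q = conv_one -> (forall n, q n.+1 <= 0) ->
  forall n, 0 <= r n.
Proof.
move=> q0 rq q_le0 n; have [m] := ubnP n; elim: m n => // m IHm [|n] nm.
  have : conv r q 0%N = 1 by rewrite rq.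
  by rewrite conv_at0 q0 mulr1 => ->; rewrite ler01.
have : conv r q n.+1 = 0 by rewrite rq.
rewrite /conv big_ord_recr/= subnn q0 mulr1 => /eqP; rewrite addrC addr_eq0 => /eqP ->.
rewrite oppr_ge0; apply: sumr_le0 => k _.
rewrite -[(_ - _)%N]prednK ?subn_gt0// mulr_ge0_le0//.
by rewrite IHm// (leq_trans (ltn_ord k)).
Qed.

(* With P, Pb, A the generating series of p, pb, cbin, the hypotheses read
   P * Pb = 1 / (1 - x) and P = e * Pb, whence (P / A)^2 = e. *)
Lemma cbin_sandwich (p pb e : nat -> R) :
    p 0%N = 1 -> pb 0%N = 1 -> (forall n, e n.+1 <= 0) ->
    conv p pb = (fun=> 1) -> conv e pb = p ->
  forall n, p n <= cbin n <= pb n.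
Proof.
move=> p0 pb0 e_le0 ppb epb n.
pose d : nat -> R := one_minus_x.
have d0 : d 0%N = 1 by rewrite /d/one_minus_x subr0.
have d1 : conv (fun=> 1) d = conv_one := conv_cst1_one_minus_x.
have a0 : cbin 0 = 1 by rewrite /cbin big_ord0.
(* Since A^2 (1 - x) = 1, multiplying by A (1 - x) is dividing by A: [q] is P / A and [r] is Pb /
   A. *)
pose q := conv (conv p cbin) d; pose r := conv (conv pb cbin) d.
have q0 : q 0%N = 1 by rewrite /q !conv_at0 p0 a0 d0 !mulr1.
have r0 : r 0%N = 1 by rewrite /r !conv_at0 pb0 a0 d0 !mulr1.
have cq (f : nat -> R) : conv cbin (conv (conv f cbin) d) = f.
  rewrite [LHS](AC (1 * ((1 * 1) * 1)) ((1 * 3) * 4 * 2))%AC/=.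
  by rewrite conv_cbin d1 conv1l.
have qq : conv q q = e.
  (* Replacing one P by e Pb groups q^2 into A^2 (1 - x), P Pb (1 - x) and e; the first two are
     1. *)
  rewrite /q -{2}epb.
  rewrite [LHS](AC (((1 * 1) * 1) * (((1 * 1) * 1) * 1))
                   (((2 * 6) * 3) * ((1 * 5) * 7) * 4))%AC/=.
  by rewrite conv_cbin ppb d1 !conv1l.
have rq : conv r q = conv_one.
  rewrite /q /r [LHS](AC (((1 * 1) * 1) * ((1 * 1) * 1))
                   (((2 * 5) * 3) * ((4 * 1) * 6)))%AC/=.
  by rewrite conv_cbin ppb d1 conv1l.
have q_le0 := conv_sqrt_le0 q0 qq e_le0.
have r_ge0 := conv_inv_ge0 q0 rq q_le0.
apply/andP; split.
  rewrite -[leLHS](congr1 (fun f => f n) (cq p)) -/q convC /conv.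
  rewrite big_ord_recl q0 mul1r subn0 gerDl; apply: sumr_le0 => k _.
  by apply: mulr_le0_ge0; [exact: q_le0|exact: cbin_ge0].
rewrite -[leRHS](congr1 (fun f => f n) (cq pb)) -/r convC /conv.
rewrite big_ord_recl r0 mul1r subn0 lerDl; apply: sumr_ge0 => k _.
by apply: mulr_ge0; [exact: r_ge0|exact: cbin_ge0].
Qed.

End CentralBinomial.

(** * Measurability of sign events, and finite partitions *)

Lemma measurable_forall_lt d (T : measurableType d) (F : nat -> set T) n :
  (forall j, measurable (F j)) ->
  measurable [set x | forall j, (j < n)%N -> F j x].
Proof.
move=> mF; have -> : [set x | forall j, (j < n)%N -> F j x] =
    \bigcap_(j in `I_n) F j by [].
exact: bigcap_measurableType.
Qed.

Section SignSets.
Context d (T : measurableType d) (R : realType) (f : T -> R).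
Hypothesis mf : measurable_fun setT f.

Let preimageT (B : set R) : measurable B -> measurable (f @^-1` B).
Proof. by move=> mB; rewrite -[_ @^-1` _]setTI; exact: mf. Qed.

Lemma measurable_lt0 : measurable [set x | f x < 0].
Proof.
have -> : [set x | f x < 0] = f @^-1` `]-oo, 0[
  by apply/seteqP; split => x; rewrite /= in_itv.
exact: preimageT.
Qed.

Lemma measurable_le0 : measurable [set x | f x <= 0].
Proof.
have -> : [set x | f x <= 0] = f @^-1` `]-oo, 0]
  by apply/seteqP; split => x; rewrite /= in_itv.
exact: preimageT.
Qed.

Lemma measurable_eq0 : measurable [set x | f x = 0].
Proof. exact: (preimageT (measurable_set1 0)). Qed.

End SignSets.

Lemma measure_partition d (T : measurableType d) (R : realType)
    (m : {measure set T -> \bar R}) n (A : set T) (F : nat -> set T) :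
    (forall k, measurable (F k)) ->
    (forall w, A w -> exists2 k, (k < n)%N & F k w) ->
    (forall k, (k < n)%N -> F k `<=` A) ->
    (forall j k w, (j < k < n)%N -> F j w -> F k w -> False) ->
  m A = (\sum_(k < n) m (F k))%E.
Proof.
move=> mF AF FA tF.
have -> : A = \big[setU/set0]_(k < n) F k.
  apply/seteqP; split => [w /AF[k kn Fk]|w].
    by rewrite -bigcup_mkord; exists k.
  by rewrite -bigcup_mkord => -[k /= kn]; exact: FA.
rewrite measure_semi_additive_ord//.
  apply/trivIsetP => j k _ _ jk; apply/seteqP; split => // w [Fj Fk].
  have [jlk|klj|/val_inj e] := ltngtP j k; last by rewrite e eqxx in jk.
  - by apply: (tF j k w) => //; rewrite jlk/=.
  - by apply: (tF k j w) => //; rewrite klj/=.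
exact: bigsetU_measurable.
Qed.

(** * Path space with the sigma-algebra generated by cylinders *)

Definition paths (R : realType) : Type := nat -> R.

HB.instance Definition _ (R : realType) := Pointed.copy (paths R) (nat -> R).

Definition cylinder (R : realType) (n : nat) (B : nat -> set R) : set (paths R) :=
  [set x | forall j, (j < n)%N -> B j (x j)].

Definition cylinders (R : realType) : set (set (paths R)) :=
  [set C | exists n B, (forall j, measurable (B j)) /\ C = cylinder n B].
Arguments cylinders R : clear implicits.

HB.instance Definition _ (R : realType) :=
  @isMeasurable.Build (sigma_display (cylinders R)) (paths R) <<s cylinders R >>
    (@sigma_algebra0 _ setT (cylinders R))
    (@sigma_algebraC (paths R) (cylinders R))
    (@sigma_algebra_bigcup _ setT (cylinders R)).

Section Paths.
Context {R : realType}.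

Lemma measurable_cylinder n (B : nat -> set R) :
  (forall j, measurable (B j)) -> measurable (cylinder n B).
Proof. by move=> mB; apply: sub_sigma_algebra; exists n, B. Qed.

Lemma setI_closed_cylinders : setI_closed (cylinders R).
Proof.
move=> _ _ [n [B [mB ->]]] [m [C [mC ->]]]; exists (maxn n m).
exists (fun j => (if (j < n)%N then B j else setT) `&`
                 (if (j < m)%N then C j else setT)); split.
  by move=> j; apply: measurableI; case: ifP.
apply/seteqP; split => [x [xB xC] j _|x xBC].
  by split; case: ifP => // jn; [exact: xB|exact: xC].
split => j jn.
  by have [] := xBC j (leq_trans jn (leq_maxl _ _)); rewrite jn.
by have [] := xBC j (leq_trans jn (leq_maxr _ _)); rewrite jn.
Qed.

Lemma measurable_coord j : measurable_fun setT (fun x : paths R => x j).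
Proof.
move=> _ Y mY; rewrite setTI.
have -> : (fun x : paths R => x j) @^-1` Y =
    cylinder j.+1 (fun i => if i == j then Y else setT).
  apply/seteqP; split => [x Yx i ij|x]; first by case: eqP => // ->.
  by move=> /(_ j (ltnSn j)); rewrite eqxx.
by apply: measurable_cylinder => i; case: ifP.
Qed.

Lemma measurable_paths d (T : measurableType d) (f : T -> paths R) :
  (forall j, measurable_fun setT (fun w => f w j)) -> measurable_fun setT f.
Proof.
move=> mf; apply: (measurability (cylinders R)) => // _ [_ [n [B [mB ->]] <-]].
rewrite setTI; apply: measurable_forall_lt => j.
by rewrite -[X in measurable X]setTI; exact: mf.
Qed.

(** Cylinders form a generating pi-system; the whole space is the cylinder of length 0, so a
    constant sequence exhausts it. *)
Lemma paths_measure_unique (m1 m2 : {measure set (paths R) -> \bar R}) :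
    (m1 setT < +oo)%E ->
    (forall n B, (forall j, measurable (B j)) ->
      m1 (cylinder n B) = m2 (cylinder n B)) ->
  forall A, measurable A -> m1 A = m2 A.
Proof.
move=> m1T m12; apply: (measure_unique (cylinders R) (fun=> setT)) => //.
- exact: setI_closed_cylinders.
- by move=> _; exists 0%N, (fun=> setT); split=> //; apply/seteqP; split.
- exact: bigcup_const.
- by move=> _ [n [B [mB ->]]]; exact: m12.
Qed.

End Paths.

(** By independence the joint law is the product of the marginals. Each section of the line x + y =
    0 is a singleton, null for the law of [g]; then integrate. *)
Lemma atomless_sum_neq0 d (T : measurableType d) (R : realType)
    (P : probability T R) (f g : {RV P >-> R}) :
    (forall A B, measurable A -> measurable B ->
      P (f @^-1` A `&` g @^-1` B) = (P (f @^-1` A) * P (g @^-1` B))%E) ->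
    (forall r, P (g @^-1` [set r]) = 0%E) ->
  P [set w | f w + g w = 0] = 0%E.
Proof.
move=> fg g0.
have mh : measurable_fun setT (fun w => (f w, g w)).
  by apply/measurable_fun_pairP; split; exact: measurable_funP.
pose h : {mfun T >-> (R * R)%type} := mfun_Sub (mem_set mh).
pose D : set (R * R) := [set z | z.1 + z.2 = 0].
have mD : measurable D.
  apply: (@measurable_eq0 _ _ _ (fun z : R * R => z.1 + z.2)).
  exact: measurable_realfun.measurable_funD.
have := @product_measure_unique _ _ _ _ _ (distribution P f) (distribution P g)
  (distribution P h) fg D mD.
move=> e; transitivity (distribution P h D) => //; rewrite -e.
rewrite /product_measure1; apply: integral0_eq => x _ /=.
have -> : xsection D x = [set - x].
  apply/seteqP; split => y; rewrite /xsection/= inE /D/=.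
    by move=> /eqP; rewrite addrC addr_eq0 => /eqP.
  by move=> ->; rewrite subrr.
exact: g0.
Qed.

(* Arbitrary finite measures are allowed, so that the lemma also applies to a
   probability restricted to an event. *)
Lemma paths_law_unique (R : realType) d1 d2 (T1 : measurableType d1)
    (T2 : measurableType d2) (m1 : {measure set T1 -> \bar R})
    (m2 : {measure set T2 -> \bar R}) (f1 : T1 -> paths R) (f2 : T2 -> paths R)
    (mf1 : measurable_fun setT f1) (mf2 : measurable_fun setT f2) :
    (m1 setT < +oo)%E ->
    (forall n B, (forall j, measurable (B j)) ->
      m1 (f1 @^-1` cylinder n B) = m2 (f2 @^-1` cylinder n B)) ->
  forall A, measurable A -> m1 (f1 @^-1` A) = m2 (f2 @^-1` A).
Proof.
exact: (@paths_measure_unique R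
  (measure_function_pushforward__canonical__measure_function_Measure m1 mf1)
  (measure_function_pushforward__canonical__measure_function_Measure m2 mf2)).
Qed.

(** * Laws and independence of random paths *)

Section IID.
Context d (T : measurableType d) (R : realType) (P : probability T R).
Implicit Types (Y : nat -> T -> R) (mu : set R -> \bar R) (A B : set (paths R)).
Local Open Scope ereal_scope.

Definition path_of Y (w : T) : paths R := Y^~ w.

(** Independence and the common law are merged into the product formula on cylinders, the form in
    which uniqueness of path laws uses them. *)
Definition iid mu Y : Prop :=
  (forall j, measurable_fun setT (Y j)) /\
  forall n C, (forall j, measurable (C j)) ->
    P (path_of Y @^-1` cylinder n C) = \prod_(j < n) mu (C j).

Lemma measurable_path_event Y A :
  (forall j, measurable_fun setT (Y j)) -> measurable A ->
  measurable (path_of Y @^-1` A).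
Proof.
move=> mY mA; rewrite -[X in measurable X]setTI.
exact: (@measurable_paths _ _ _ (path_of Y)).
Qed.

Lemma iid_same_law mu Y Z A :
  iid mu Y -> iid mu Z -> measurable A ->
  P (path_of Y @^-1` A) = P (path_of Z @^-1` A).
Proof.
move=> [mY iY] [mZ iZ]; apply: paths_law_unique.
- exact: measurable_paths.
- exact: measurable_paths.
- by rewrite -ge0_fin_numE ?measure_ge0//; exact: fin_num_measure.
- by move=> n B mB; exact: etrans (iY n B mB) (esym (iZ n B mB)).
Qed.

(** Uniqueness is applied to one path at a time, the other being frozen in an event [E]: restricting
    [P] to [E] and scaling [P] by [P E] give path laws that agree on cylinders. *)
Lemma paths_independence Y Z :
    (forall j, measurable_fun setT (Y j)) ->
    (forall j, measurable_fun setT (Z j)) ->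
    (forall n m C D, (forall j, measurable (C j)) -> (forall j, measurable (D j)) ->
      P (path_of Y @^-1` cylinder n C `&` path_of Z @^-1` cylinder m D) =
      P (path_of Y @^-1` cylinder n C) * P (path_of Z @^-1` cylinder m D)) ->
  forall A B, measurable A -> measurable B ->
    P (path_of Y @^-1` A `&` path_of Z @^-1` B) =
    P (path_of Y @^-1` A) * P (path_of Z @^-1` B).
Proof.
move=> mY mZ YZ.
have extend (E : set T) W : measurable E -> (forall j, measurable_fun setT (W j)) ->
    (forall n C, (forall j, measurable (C j)) ->
      P (path_of W @^-1` cylinder n C `&` E) =
      P E * P (path_of W @^-1` cylinder n C)) ->
    forall A, measurable A ->
      P (path_of W @^-1` A `&` E) = P E * P (path_of W @^-1` A).
  move=> mE mW WE A mA.
  have PE : P E \is a fin_num by exact: fin_num_measure.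
  have PE0 : (0 <= fine (P E))%R by exact: fine_ge0.
  rewrite -(fineK PE).
  apply: (@paths_law_unique R _ _ _ _ (mrestr P mE) (mscale (NngNum PE0) P)).
  - exact: measurable_paths.
  - exact: measurable_paths.
  - by rewrite /= /mrestr setTI -ge0_fin_numE.
  - move=> n C mC; rewrite /= /mrestr /mscale/= fineK//.
    exact: WE.
  - exact: mA.
move=> A B mA mB.
have mZB : measurable (path_of Z @^-1` B) by exact: measurable_path_event.
rewrite [RHS]muleC; apply: (extend) => // n C mC.
rewrite setIC [RHS]muleC.
apply: (extend) => //.
  by apply: measurable_path_event => //; exact: measurable_cylinder.
by move=> m D mD; rewrite setIC YZ.
Qed.

End IID.

(** * Deterministic walks: reversal, first maximum, first return to 0 *)

Section Walk.
Context {R : realType}.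
Implicit Types x y : paths R.

Definition walk x (k : nat) : R := \sum_(i < k) x i.

Definition neg n : set (paths R) :=
  [set x | forall k, (k < n)%N -> walk x k.+1 < 0].

Definition nonpos n : set (paths R) :=
  [set x | forall k, (k < n)%N -> walk x k.+1 <= 0].

(** The return takes place at time [n.+1], after [n] negative sums. *)
Definition first_zero n : set (paths R) := neg n `&` [set x | walk x n.+1 = 0].

Definition record n : set (paths R) :=
  [set x | forall j, (j < n)%N -> walk x j < walk x n].

Lemma walk0 x : walk x 0 = 0.
Proof. by rewrite /walk big_ord0. Qed.

Lemma walkS x k : walk x k.+1 = walk x k + x k.
Proof. by rewrite /walk big_ord_recr. Qed.

Lemma eq_walk x y k : (forall j, (j < k)%N -> x j = y j) -> walk x k = walk y k.
Proof. by move=> xy; apply: eq_bigr => i _; exact: xy. Qed.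

Lemma walk_shift x k j : walk (fun i => x (k + i)%N) j = walk x (k + j) - walk x k.
Proof. by rewrite /walk big_split_ord/= addrC addrK. Qed.

(** Indices from [k] on stay fixed, which makes this a permutation of all of [nat] and so applicable
    to whole paths. *)
Definition rev_index k j : nat := if (j < k)%N then (k - j.+1)%N else j.

Lemma rev_indexK k : involutive (rev_index k).
Proof.
move=> j; rewrite /rev_index; case: (ltnP j k) => [jk|kj]/=.
  by rewrite ltn_subrL (leq_ltn_trans _ jk)//= subnSK// subKn// ltnW.
by rewrite ltnNge kj.
Qed.

Lemma walk_rev x k i : (i <= k)%N ->
  walk (fun j => - x (rev_index k j)) i = walk x (k - i) - walk x k.
Proof.
elim: i => [|i IHi] ik; first by rewrite walk0 subn0 subrr.
rewrite walkS IHi 1?ltnW// /rev_index ik -(subnSK ik) walkS.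
by rewrite addrAC addrK.
Qed.

(** The reversed, negated path has partial sums S_(k-i) - S_k, which are all negative exactly when
    S_k exceeds every earlier sum. *)
Lemma record_rev x k : record k x <-> neg k (fun j => - x (rev_index k j)).
Proof.
split=> [rx i ik|nx j jk].
  by rewrite walk_rev// subr_lt0; apply: rx; rewrite ltn_subrL (leq_ltn_trans _ ik).
have := nx (k - j.+1)%N; rewrite subnSK// walk_rev ?leq_subr// subKn 1?ltnW//.
by rewrite subr_lt0; exact.
Qed.

(** Strict before k and weak after: this selects the first maximizer, and is why a strict and a weak
    event meet in [max_decomposition]. *)
Lemma exists_first_max (u : nat -> R) n : exists2 k, (k < n.+1)%N &
  (forall j, (j < k)%N -> u j < u k) /\ (forall j, (k <= j <= n)%N -> u j <= u k).
Proof.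
elim: n => [|n [k kn [uk ku]]].
  by exists 0%N => //; split => // -[].
have le_uk j : (j <= n)%N -> u j <= u k.
  by move=> jn; case: (ltnP j k) => [/uk/ltW//|kj]; apply: ku; rewrite kj.
have [un|un] := leP (u n.+1) (u k).
  exists k; first exact: ltnW; split => // j /andP[kj].
  by rewrite leq_eqVlt => /predU1P[->//|]; exact: le_uk.
exists n.+1 => //; split => [j jn|j]; first exact: le_lt_trans (le_uk _ jn) un.
by rewrite -eqn_leq => /eqP <-.
Qed.

Lemma nonpos_first_zero x n : nonpos n x ->
  neg n x \/ exists2 k, (k < n)%N & first_zero k x.
Proof.
elim: n => [|n IHn] nx; first by left.
have [|nn|[k kn zk]] := IHn; first by move=> k kn; apply: nx; exact: ltnW.
  have := nx n (ltnSn n); rewrite le_eqVlt => /predU1P[zn|lt0].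
    by right; exists n.
  by left => k; rewrite ltnS leq_eqVlt => /predU1P[->//|]; exact: nn.
by right; exists k => //; exact: ltnW.
Qed.

Lemma measurable_walk k : measurable_fun setT (walk ^~ k).
Proof. by apply: measurable_sum => i; exact: measurable_coord. Qed.

Lemma measurable_neg n : measurable (neg n).
Proof. by apply: measurable_forall_lt => k; exact: (measurable_lt0 (measurable_walk _)). Qed.

Lemma measurable_nonpos n : measurable (nonpos n).
Proof. by apply: measurable_forall_lt => k; exact: (measurable_le0 (measurable_walk _)). Qed.

Lemma measurable_first_zero n : measurable (first_zero n).
Proof.
apply: measurableI; first exact: measurable_neg.
exact: (measurable_eq0 (measurable_walk _)).
Qed.

Lemma measurable_record n : measurable (record n).
Proof.
have -> : record n = [set x | forall j, (j < n)%N -> walk x j - walk x n < 0].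
  by apply/seteqP; split => x rx j /rx; rewrite subr_lt0.
apply: measurable_forall_lt => j; apply: measurable_lt0.
by apply: measurable_realfun.measurable_funB; exact: measurable_walk.
Qed.

(** This and the next two lemmas say that the events depend on finitely many increments, as
    [past_future_independence] requires. *)
Lemma eq_neg x y n : (forall j, (j < n)%N -> x j = y j) -> neg n x -> neg n y.
Proof.
move=> xy nx k kn; rewrite -(@eq_walk x) ?nx// => j jk.
by apply: xy; exact: leq_trans jk kn.
Qed.

Lemma eq_first_zero x y n :
  (forall j, (j < n.+1)%N -> x j = y j) -> first_zero n x -> first_zero n y.
Proof.
move=> xy [nx zx]; split; last by rewrite /= -(eq_walk xy).
by apply: eq_neg nx => j jn; apply: xy; exact: ltnW.
Qed.

Lemma eq_record x y n :
  (forall j, (j < n)%N -> x j = y j) -> record n x -> record n y.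
Proof.
move=> xy rx j jn; rewrite -(eq_walk xy) -(@eq_walk x) ?rx// => i ij.
by apply: xy; exact: ltn_trans ij jn.
Qed.

End Walk.

(** * From the hypotheses on the variables to [iid] paths *)

Section RandomVariables.
Context d (T : measurableType d) (R : realType) (P : probability T R).
Context (X : nat -> {RV P >-> R}).
Hypothesis Xindep : independent_RVs X.
Hypothesis Xident : forall i, same_distribution P (X i) (X 0%N).
Local Open Scope ereal_scope.

Local Notation mu := (distribution P (X 0%N)).

(** The left inverse makes [f] injective, so independence applies to the distinct indices f 0, ...,
    f (n-1). Shifts and reversals are both of this kind. *)
Lemma iid_reindex (f g : nat -> nat) : cancel f g -> iid P mu (fun j => X (f j)).
Proof.
move=> fK; split=> [j|n C mC]; first exact: measurable_funP.
pose J := [seq f j | j <- index_iota 0 n].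
have -> : path_of (fun j => X (f j)) @^-1` cylinder n C =
    \bigcap_(i in [set` J]) (X i @^-1` C (g i)).
  apply/seteqP; split => [w wC _ /mapP[j + ->]|w wC j jn].
    by rewrite mem_index_iota/= fK => jn; exact: wC.
  by have := wC (f j); rewrite /= fK; apply; rewrite map_f// mem_index_iota.
rewrite Xindep ?map_inj_uniq ?iota_uniq//; last exact: can_inj fK.
rewrite big_map big_mkord; apply: eq_bigr => j _; rewrite fK.
exact: Xident.
Qed.

Lemma iid_opp (Y : nat -> T -> R) : symmetric_RV P (X 0%N) ->
  iid P mu Y -> iid P mu (fun j w => - Y j w)%R.
Proof.
move=> Xsym [mY iY]; split => [j|n C mC]; first exact: measurable_realfun.measurable_funN.
have mNC j : measurable (-%R @^-1` C j).
  rewrite -[X in measurable X]setTI.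
  exact: measurable_realfun.oppr_measurable.
rewrite [LHS](iY n (fun j => -%R @^-1` C j))//.
by apply: eq_bigr => j _; exact/esym/Xsym.
Qed.

End RandomVariables.

(** * Path decompositions of the random walk *)

Section RandomWalk.
Context d (T : measurableType d) (R : realType) (P : probability T R).
Context (mu : set R -> \bar R) (X : nat -> T -> R).
Hypothesis iid_X : forall f g : nat -> nat, cancel f g ->
  iid P mu (fun j => X (f j)).
Local Open Scope ereal_scope.

Let mX j : measurable_fun setT (X j).
Proof. by have [+ _] := @iid_X id id (fun=> erefl); exact. Qed.

Definition shift k : nat -> T -> R := fun j => X (k + j).

Lemma iid_shift k : iid P mu (shift k).
Proof. by apply: (@iid_X _ (fun i => i - k)%N) => j; rewrite addKn. Qed.

Lemma past_future_independence k (A B : set (paths R)) :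
    measurable A -> measurable B ->
    (forall x y : paths R, (forall j, (j < k)%N -> x j = y j) -> A x -> A y) ->
  P (path_of X @^-1` A `&` path_of (shift k) @^-1` B) =
  P (path_of X @^-1` A) * P (path_of X @^-1` B).
Proof.
move=> mA mB depA.
(* [Y] keeps the first [k] increments and is 0 afterwards: it determines [A], and its independence
   from the shifted path can be tested on cylinders. *)
pose Y j w := (if (j < k)%N then X j w else 0)%R.
have mY j : measurable_fun setT (Y j).
  rewrite /Y; case: (j < k)%N => //; exact: measurable_cst.
have -> : path_of X @^-1` A = path_of Y @^-1` A.
  by apply/seteqP; split => w; apply: depA => j jk; rewrite /path_of/= /Y jk.
have iidX := @iid_X id id (fun=> erefl).
rewrite -(iid_same_law (iid_shift k) iidX mB).
apply: paths_independence => //; first by move=> j; rewrite /shift.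
move=> n m C D mC mD.
(* Beyond [k] the constraints bear on the constant 0: they hold surely, or the cylinder event is
   empty. *)
have [C0|] := pselect (forall j, (k <= j < n)%N -> C j 0%R); last first.
  move=> /existsNP[j /not_implyP[/andP[kj jn] Cj]].
  have -> : path_of Y @^-1` cylinder n C = set0.
    apply/seteqP; split => // w /(_ j jn).
    by rewrite /path_of/= /Y ltnNge kj.
  by rewrite set0I measure0 mul0e.
pose C' j := if (j < n)%N then C j else setT.
have mC' j : measurable (C' j) by rewrite /C'; case: ifP.
have -> : path_of Y @^-1` cylinder n C = path_of X @^-1` cylinder k C'.
  apply/seteqP; split => w wC j => [jk|jn].
    by rewrite /C'; case: ifPn => // /wC; rewrite /path_of/= /Y jk.
  rewrite /path_of/= /Y; case: ltnP => [/wC|kj]; first by rewrite /C' jn.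
  by apply: C0; rewrite kj.
(* Concatenating the constraints on past and future gives a single cylinder of length k + m. *)
pose E j := if (j < k)%N then C' j else D (j - k)%N.
have mE j : measurable (E j) by rewrite /E; case: ifP.
have -> : path_of X @^-1` cylinder k C' `&` path_of (shift k) @^-1` cylinder m D =
    path_of X @^-1` cylinder (k + m) E.
  apply/seteqP; split => [w [wC wD] j jkm|w wE].
    rewrite /E; case: ltnP => [|kj]; first exact: wC.
    by have := wD (j - k)%N; rewrite ltn_subLR// /path_of/shift/= subnKC//; apply.
  split => [j jk|j jm].
    by have := wE j (ltn_addr _ jk); rewrite /E jk.
  by have := wE (k + j)%N; rewrite ltn_add2l jm /E ltnNge leq_addr/= addKn; exact.
have [_ iX] := iidX; have [_ iS] := iid_shift k.
rewrite iX// iX// iS// big_split_ord/=; congr (_ * _); apply: eq_bigr => j _.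
  by rewrite /E ltn_ord.
by rewrite /E ltnNge leq_addr/= addKn.
Qed.

Local Notation prob A := (P (path_of X @^-1` A)).

Lemma shift_path (w : T) k : path_of (shift k) w = (fun i => path_of X w (k + i)%N).
Proof. by []. Qed.

(** Duality: reversing and negating the increments preserves the law and carries [neg n] to
    [record n]. *)
Lemma prob_record n :
  (forall Y, iid P mu Y -> iid P mu (fun j w => - Y j w)%R) ->
  prob (record n) = prob (neg n).
Proof.
move=> iid_opp.
have iid_rev := iid_opp _ (iid_X (rev_indexK n)).
rewrite -(iid_same_law iid_rev (@iid_X id id (fun=> erefl)) (measurable_neg n)).
congr (P _); apply/seteqP; split => w; first by move/record_rev.
by move=> nw; apply/record_rev.
Qed.

Lemma max_decomposition n :
  (forall Y, iid P mu Y -> iid P mu (fun j w => - Y j w)%R) ->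
  \sum_(k < n.+1) prob (neg k) * prob (nonpos (n - k)) = 1.
Proof.
move=> iid_opp; rewrite -(probability_setT P).
(* [F k] says that the first maximum over times 0 to n is at k. *)
pose F k := path_of X @^-1` record k `&` path_of (shift k) @^-1` nonpos (n - k).
rewrite [RHS](@measure_partition _ _ _ _ n.+1 _ F)//.
- apply: eq_bigr => k _; rewrite -prob_record//.
  apply/esym/past_future_independence.
  + exact: measurable_record.
  + exact: measurable_nonpos.
  + by move=> x y; exact: eq_record.
- move=> k; apply: measurableI; apply: measurable_path_event => //.
  + exact: measurable_record.
  + by move=> j; rewrite /shift.
  + exact: measurable_nonpos.
- move=> w _; have [k kn [wk kw]] := exists_first_max (walk (path_of X w)) n.
  exists k => //; split; first exact: wk.
  move=> j jnk; rewrite shift_path walk_shift subr_le0; apply: kw.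
  by rewrite leq_addr/= addnS -ltn_subRL.
- move=> j k w /andP[jk kn] [_ jw] [kw _].
  (* Two such times j < k would give both S_k <= S_j and S_j < S_k. The predecessor appears because
     index i of [nonpos] concerns the sum at i + 1. *)
  have := jw (k - j).-1; rewrite prednK ?subn_gt0// shift_path walk_shift.
  by rewrite (subnKC (ltnW jk)) subr_le0 leNgt kw// => /(_ (@leq_sub2r j k n kn)).
Qed.

Lemma zero_decomposition n :
  prob (nonpos n) = prob (neg n) +
    \sum_(k < n) prob (first_zero k) * prob (nonpos (n - k.+1)).
Proof.
(* Slot k < n holds the paths first returning to 0 at time k + 1; the last slot n holds those that
   never return. *)
pose F k := if (k < n)%N then
    path_of X @^-1` first_zero k `&` path_of (shift k.+1) @^-1` nonpos (n - k.+1)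
  else path_of X @^-1` neg n.
rewrite (@measure_partition _ _ _ _ n.+1 _ F)//.
- rewrite big_ord_recr/= {2}/F ltnn addrC; congr (_ + _).
  apply: eq_bigr => k _; rewrite /F ltn_ord.
  apply: past_future_independence.
  + exact: measurable_first_zero.
  + exact: measurable_nonpos.
  + by move=> x y; exact: eq_first_zero.
- move=> k; rewrite /F; case: ifP => _; last first.
    by apply: measurable_path_event => //; exact: measurable_neg.
  apply: measurableI; apply: measurable_path_event => //.
  + exact: measurable_first_zero.
  + by move=> j; rewrite /shift.
  + exact: measurable_nonpos.
- move=> w nw; have [negw|[k kn zk]] := nonpos_first_zero nw.
    by exists n; rewrite // /F ltnn.
  exists k; first exact: ltnW.
  rewrite /F kn; split => // j jnk; case: zk => _ /= zk.
  by rewrite shift_path walk_shift zk subr0; apply: (nw (k + j.+1)%N); rewrite addnS -addSn -ltn_subRL.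
- move=> k _ w; rewrite /F; case: ifP => [kn [[negw zk] nw] j jn|_ negw j jn]; last first.
    exact/ltW/negw.
  have [jk|kj] := ltnP j k; first exact/ltW/negw.
  move: kj; rewrite leq_eqVlt => /predU1P[<-|kj]; first by rewrite zk.
  have := nw (j - k.+1)%N; rewrite shift_path walk_shift zk subr0 -subSn// (@subnKC k.+1 j.+1 (ltnW kj)).
  by apply; exact: leq_sub2r.
(* Slot j forces the sum at j + 1 to vanish, whereas every later slot makes it negative. *)
- move=> j k w /andP[jk]; rewrite ltnS => kn.
  rewrite /F (leq_trans jk kn) => -[[_ zj] _] Fk.
  have : (walk (path_of X w) j.+1 < 0)%R; last by rewrite zj ltxx.
  by move: Fk; case: ifP => [_ [[+ _] _]|_]; apply => //; exact: leq_trans jk kn.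
Qed.

(** The event forces S_k + X_k = 0, where S_k and the atomless increment X_k are independent as past
    and future. *)
Lemma prob_first_zero_atomless k :
  (forall j r, P (X j @^-1` [set r]) = 0) -> prob (first_zero k) = 0.
Proof.
move=> X0.
have mwalk : measurable_fun setT (fun w => walk (path_of X w) k).
  by apply: (measurableT_comp (measurable_walk k)); exact: measurable_paths.
pose f : {RV P >-> R} := mfun_Sub (mem_set mwalk).
pose g : {RV P >-> R} := mfun_Sub (mem_set (mX k)).
have fg A B : measurable A -> measurable B ->
    P (f @^-1` A `&` g @^-1` B) = P (f @^-1` A) * P (g @^-1` B).
  move=> mA mB.
  have mA' : measurable ((walk ^~ k) @^-1` A : set (paths R)).
    by rewrite -[X in measurable X]setTI; exact: measurable_walk.
  have mB' j : measurable ((fun x : paths R => x j) @^-1` B).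
    by rewrite -[X in measurable X]setTI; exact: measurable_coord.
  have dep (x y : paths R) : (forall j, (j < k)%N -> x j = y j) ->
      ((walk ^~ k) @^-1` A) x -> ((walk ^~ k) @^-1` A) y.
    by move=> xy; rewrite /preimage/= (eq_walk xy).
  have := past_future_independence mA' (mB' 0%N) dep.
  (* The increment X_k is coordinate 0 of the path shifted by k. *)
  have -> : P (path_of X @^-1` ((fun x => x 0%N) @^-1` B)) = P (g @^-1` B).
    have [_ iX] := @iid_X id id (fun=> erefl).
    have := iid_same_law (iid_shift k) (@iid_X id id (fun=> erefl)) (mB' 0%N).
    by rewrite /shift /path_of/= => <-; rewrite /preimage/= addn0.
  by rewrite /shift /path_of /preimage/= addn0.
apply/eqP; rewrite eq_le measure_ge0 andbT.
rewrite -(@atomless_sum_neq0 _ _ _ P f g fg (X0 k)); apply: le_measure.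
- rewrite inE; apply: measurable_path_event => //; exact: measurable_first_zero.
- rewrite inE; apply: (@measurable_eq0 _ _ _ (fun w => f w + g w)%R).
  exact: measurable_realfun.measurable_funD.
- by move=> w [_ /=]; rewrite walkS.
Qed.

End RandomWalk.

(** * Back to the maximum of the partial sums, and conclusion *)

Lemma neg_max (R : realType) (T : Type) (X : nat -> T -> R) n w : (1 <= n)%N ->
  (max_partial_sum X n w < 0) <-> neg n (X^~ w : paths R).
Proof.
move=> n1; split=> [lt0 k kn|nw].
  apply: le_lt_trans lt0; rewrite /max_partial_sum.
  by apply: (@le_bigmax_seq _ _ _ _ _ k.+1) => //; rewrite mem_index_iota.
(* The seed S_1 is handled by index 0 of [neg n], available since 1 <= n. *)
rewrite /max_partial_sum big_seq_cond; apply: bigmax_lt; first exact: nw.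
move=> -[|k]; rewrite mem_index_iota ?andbF// => /andP[/andP[_ kn] _].
exact: nw.
Qed.

Lemma nonpos_max (R : realType) (T : Type) (X : nat -> T -> R) n w : (1 <= n)%N ->
  (max_partial_sum X n w <= 0) <-> nonpos n (X^~ w : paths R).
Proof.
move=> n1; split=> [le0 k kn|nw].
  apply: le_trans le0; rewrite /max_partial_sum.
  by apply: (@le_bigmax_seq _ _ _ _ _ k.+1) => //; rewrite mem_index_iota.
rewrite /max_partial_sum big_seq_cond; apply: bigmax_le; first exact: nw.
move=> -[|k]; rewrite mem_index_iota ?andbF// => /andP[/andP[_ kn] _].
exact: nw.
Qed.

Theorem proposition1p4 (R : realType) (d : measure_display)
    (T : measurableType d) (P : probability T R) (X : nat -> {RV P >-> R})
    (Xindep : independent_RVs X)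
    (Xident : forall i, same_distribution P (X i) (X 0%N))
    (Xmean : mean_zero P (X 0%N))
    (Xsym : symmetric_RV P (X 0%N)) :
  (forall n : nat, (1 <= n)%N ->
     (persistence X n <=
        ((double_factorial (2 * n - 1))%:R / (double_factorial (2 * n))%:R)%:E
      <= weak_persistence X n)%E) /\
  (has_density (X 0%N) ->
   forall n : nat, (1 <= n)%N ->
     persistence X n =
       ((double_factorial (2 * n - 1))%:R / (double_factorial (2 * n))%:R)%:E).
Proof.
pose mu := distribution P (X 0%N).
pose Y j : T -> R := X j.
have iidY f g : cancel f g -> iid P mu (fun j => Y (f j)) by exact: iid_reindex.
have mY j : measurable_fun setT (Y j) by have [+ _] := iidY id id (fun=> erefl); exact.
have iidN Z : iid P mu Z -> iid P mu (fun j w => - Z j w) by exact: iid_opp.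
pose prob A := fine (P (path_of Y @^-1` A)).
have probE A : measurable A -> P (path_of Y @^-1` A) = (prob A)%:E.
  by move=> mA; rewrite fineK// fin_num_measure//; exact: measurable_path_event.
have prob_ge0 A : 0 <= prob A by exact: fine_ge0.
(* This is the series 1 - E, as [first_zero k'] is a return at time k' + 1. *)
pose e k := if k is k'.+1 then - prob (first_zero k') else 1.
have e_le0 k : e k.+1 <= 0 by rewrite oppr_le0.
have conv_max : conv (prob \o neg) (prob \o nonpos) = fun=> 1.
  apply/funext => n; apply: EFin_inj; rewrite -(max_decomposition iidY n iidN).
  rewrite /conv -sumEFin; apply: eq_bigr => k _.
  rewrite EFinM/= -!probE//; [exact: measurable_nonpos|exact: measurable_neg].
have zeroE n : prob (nonpos n) = prob (neg n) +
    \sum_(k < n) prob (first_zero k) * prob (nonpos (n - k.+1)).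
  apply: EFin_inj; rewrite EFinD -sumEFin -!probE; last 2 first.
  - exact: measurable_neg.
  - exact: measurable_nonpos.
  rewrite (zero_decomposition iidY n); congr (_ + _)%E; apply: eq_bigr => k _.
  rewrite EFinM/= -!probE//; [exact: measurable_nonpos|exact: measurable_first_zero].
have conv_zero : conv e (prob \o nonpos) = prob \o neg.
  apply/funext => n; rewrite /conv big_ord_recl/= mul1r subn0 zeroE -addrA.
  rewrite -big_split/= big1 ?addr0// => k _.
  by rewrite /bump/= add1n mulNr subrr.
have prob0 (A : set (paths R)) : A = setT -> prob A = 1.
  by move=> ->; rewrite /prob preimage_setT probability_setT.
have sandwich := cbin_sandwich (prob0 (neg 0) _) (prob0 (nonpos 0) _)
  e_le0 conv_max conv_zero.
have {}sandwich n : prob (neg n) <= cbin n <= prob (nonpos n).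
  by apply: sandwich; apply/seteqP; split.
have persE n : (1 <= n)%N -> persistence X n = (prob (neg n))%:E.
  move=> n1; rewrite -probE; last exact: measurable_neg.
  by congr (P _); apply/seteqP; split => w /(neg_max Y w n1).
have wpersE n : (1 <= n)%N -> weak_persistence X n = (prob (nonpos n))%:E.
  move=> n1; rewrite -probE; last exact: measurable_nonpos.
  by congr (P _); apply/seteqP; split => w /(nonpos_max Y w n1).
split => [n n1|Xdens n n1].
  by rewrite persE// wpersE// double_factorial_cbin !lee_fin.
have atomless j r : P (Y j @^-1` [set r]) = 0%E.
  (* Singletons are Lebesgue null, hence null for the absolutely continuous common law. *)
  rewrite [LHS](Xident j [set r])//.
  have /null_content_dominatesP := Xdens; apply => //.
  exact: lebesgue_measure_set1.
rewrite persE// double_factorial_cbin; congr EFin; apply/eqP.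
have /andP[le1 le2] := sandwich n.
(* All return terms in [zeroE] vanish, so the two ends of the sandwich coincide. *)
rewrite eq_le le1 (le_trans le2)// zeroE big1 ?addr0// => k _.
by rewrite /prob (prob_first_zero_atomless iidY _ atomless)/= mul0r.
Qed.
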